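(* Let $\eta$ be any positive equivalence relation. The class $\mathcal C$ consisting of all sets $A_n$ ($n\in\mathbb N$) together with all sets $[a_{n+1}]$ with $n\in K'$ is an $\eta$-family that is weakly confidently learnable but not class-preservingly weakly confidently learnable.
   Context: A positive equivalence relation is an equivalence relation $\eta$ on $\mathbb{N}$ that is recursively enumerable (as a set of pairs) and has infinitely many equivalence classes. For $x\in\mathbb N$ let $[x]=\{y:y\,\eta\,x\}$. Let $a_0<a_1<\cdots$ be the least elements of the $\eta$-equivalence classes in increasing order and $A_n=\bigcup_{m<n}[a_m]$. $K$ is the halting problem and $K'=\{e:\varphi^K_e(e)\text{ converges}\}$ its jump. A set is $\eta$-closed if it is a union of $\eta$-classes. An $\eta$-family is an infinite family of $\eta$-closed sets possessing a uniformly r.e. one-one numbering $B_0,B_1,\dots$ (i.e. $\{\langle k,x\rangle:x\in B_k\}$ is r.e. and $B_i\neq B_j$ for $i\ne j$). $W_0,W_1,\dots$ is a fixed acceptable numbering of the r.e. sets. A text for $L$ is a total $T:\mathbb N\to\mathbb N\cup\{\#\}$ whose range minus $\{\#\}$ is $L$; $T[n]$ is its initial segment of length $n$, and $\mathrm{cnt}(T)$ its range minus $\{\#\}$. A learner is a recursive function $M$ from finite sequences over $\mathbb N\cup\{\#\}$ to $\mathbb N\cup\{?\}$; by default an output $e$ is interpreted as ''the $\eta$-closure of $W_e$''. Relative to an interpretation of hypotheses, $M$ weakly confidently learns $\mathcal C$ if on every text $T$ for every $L\in\mathcal C$ it outputs from some point on a single index whose hypothesis equals $L$, and moreover $M(T[n])$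 converges on every text $T$ with $\mathrm{cnt}(T)\subseteq L$ for some $L\in\mathcal C$. $\mathcal C$ is class-preservingly weakly confidently learnable if there is a uniformly r.e. hypothesis space $H_0,H_1,\dots$ with $\{H_i:i\in\mathbb N\}=\mathcal C$ and a learner weakly confidently learning $\mathcal C$ when output $i$ is interpreted as $H_i$. *)

(* Defs.v *)
From Stdlib Require Import RelationClasses Cantor.
From mathcomp Require Import all_boot.
From mathcomp Require Import boolp classical_sets functions cardinality.

Set Implicit Arguments.
Unset Strict Implicit.
Unset Printing Implicit Defensive.

Local Open Scope classical_set_scope.

Definition npair (x y : nat) : nat := Cantor.to_nat (x, y).
Definition nfst (z : nat) : nat := (Cantor.of_nat z).1.
Definition nsnd (z : nat) : nat := (Cantor.of_nat z).2.

(** Kleene's schemes for unary functions; several arguments are passed through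
    the (bijective) Cantor pairing, so projections and substitution into several
    arguments are obtained from [CFst], [CSnd], [CPair] and [CComp]. *)
Inductive code : Type :=
  | CZero | CSucc | CFst | CSnd | COracle
  | CPair of code & code
  | CComp of code & code
  | CPrec of code & code
  | CMu of code.

(** [eval A c x y]: with oracle [A], the program [c] halts on input [x] with
    output [y].  In the recursion case, [c <x, 0> = d x] and
    [c <x, n+1> = e <x, <n, c <x, n>>>]; in the minimization case, the values
    below the result have to be defined and nonzero. *)
Fixpoint eval (A : set nat) (c : code) (x y : nat) {struct c} : Prop :=
  match c with
  | CZero => y = 0
  | CSucc => y = x.+1
  | CFst => y = nfst x
  | CSnd => y = nsnd x
  | COracle => y = nat_of_bool `[< A x >]
  | CPair d e => exists u v, [/\ eval A d x u, eval A e x v & y = npair u v]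
  | CComp d e => exists2 u, eval A e x u & eval A d u y
  | CPrec d e =>
      (fix loop (n r : nat) {struct n} : Prop :=
         match n with
         | 0 => eval A d (nfst x) r
         | m.+1 => exists2 s, loop m s &
                     eval A e (npair (nfst x) (npair m s)) r
         end) (nsnd x) y
  | CMu d => eval A d (npair x y) 0 /\
      forall m, m < y -> exists k, eval A d (npair x m) k.+1
  end.

(** Partial functions are represented by their graphs. *)
Definition partial_recursive_in (A : set nat) (f : nat -> nat -> Prop) : Prop :=
  exists c, forall x y, f x y <-> eval A c x y.

Definition recursive (f : nat -> nat) : Prop :=
  partial_recursive_in set0 (fun x y => y = f x).

Definition re (S : set nat) : Prop :=
  exists2 f, partial_recursive_in set0 f & S = [set x | exists y, f x y].

(** Recursive enumerability of a binary relation as a set of pairs; for a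
    sequence of sets [B : nat -> set nat] this says that [B] is uniformly r.e. *)
Definition re2 (B : nat -> nat -> Prop) : Prop :=
  re [set z | B (nfst z) (nsnd z)].

(** Acceptable numberings in Rogers' sense. [psi e x y] reads [psi_e(x) = y].
    Applied to the functions [g] that ignore their first argument, the second
    clause says that every partial recursive function occurs. *)
Definition acceptable_in (A : set nat) (psi : nat -> nat -> nat -> Prop) : Prop :=
  partial_recursive_in A (fun z y => psi (nfst z) (nsnd z) y) /\
  forall g, partial_recursive_in A g ->
    exists2 f, recursive f & forall e x y, g (npair e x) y <-> psi (f e) x y.

(** [phi A e x y] reads [phi^A_e(x) = y]. *)
Definition acceptable_system (phi : set nat -> nat -> nat -> nat -> Prop) : Prop :=
  forall A, acceptable_in A (phi A).

Definition acceptable_re (W : nat -> set nat) : Prop :=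
  re2 W /\
  forall V : nat -> set nat, re2 V ->
    exists2 f, recursive f & forall i, V i = W (f i).

Definition jump (phi : set nat -> nat -> nat -> nat -> Prop) (A : set nat) :
    set nat :=
  [set e | exists y, phi A e e y].

Definition halting_problem (phi : set nat -> nat -> nat -> nat -> Prop) : set nat :=
  jump phi set0.

Definition eqclass (eta : nat -> nat -> Prop) (x : nat) : set nat :=
  [set y | eta y x].

Record positive (eta : nat -> nat -> Prop) : Prop := Positive {
  positive_equiv : Equivalence eta;
  positive_re : re2 eta;
  positive_infinite : infinite_set (range (eqclass eta))
}.

(** The right-hand set consists of the least elements of the classes. *)
Definition least_reps (eta : nat -> nat -> Prop) (a : nat -> nat) : Prop :=
  (forall m n, m < n -> a m < a n) /\
  range a = [set x | forall y, eta y x -> x <= y].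

Definition initial_union (eta : nat -> nat -> Prop) (a : nat -> nat) (n : nat) :
    set nat :=
  \bigcup_(m in [set m | m < n]) eqclass eta (a m).

Definition eta_closure (eta : nat -> nat -> Prop) (S : set nat) : set nat :=
  \bigcup_(x in S) eqclass eta x.

Definition eta_closed (eta : nat -> nat -> Prop) (S : set nat) : Prop :=
  exists X : set nat, S = eta_closure eta X.

Definition eta_family (eta : nat -> nat -> Prop) (C : set (set nat)) : Prop :=
  [/\ infinite_set C,
      forall L, C L -> eta_closed eta L &
      exists B : nat -> set nat, [/\ re2 B, injective B & range B = C]].

(** [None] is the pause symbol # in a text and the symbol ? in the output of a
    learner. *)
Definition text := nat -> option nat.

Definition content (T : text) : set nat := [set x | exists n, T n = Some x].

Definition learner := seq (option nat) -> option nat.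

Definition encode_option (o : option nat) : nat :=
  if o is Some x then x.+1 else 0.

Definition encode_seq (s : seq (option nat)) : nat :=
  foldr (fun o z => (npair (encode_option o) z).+1) 0 s.

Definition recursive_learner (M : learner) : Prop :=
  exists2 f, recursive f &
    forall s, f (encode_seq s) = encode_option (M s).

Definition converges_to (M : learner) (T : text) (v : option nat) : Prop :=
  exists N, forall n, N <= n -> M (mkseq T n) = v.

(** [H e] is the interpretation of the output [e]. *)
Definition weakly_confidently_learns (H : nat -> set nat) (M : learner)
    (C : set (set nat)) : Prop :=
  (forall L T, C L -> content T = L ->
     exists2 e, converges_to M T (Some e) & H e = L) /\
  (forall L T, C L -> content T `<=` L -> exists v, converges_to M T v).

Definition weakly_confidently_learnable (W : nat -> set nat)
    (eta : nat -> nat -> Prop) (C : set (set nat)) : Prop :=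
  exists2 M, recursive_learner M &
    weakly_confidently_learns (fun e => eta_closure eta (W e)) M C.

Definition class_preservingly_weakly_confidently_learnable
    (C : set (set nat)) : Prop :=
  exists H : nat -> set nat, [/\ re2 H, range H = C &
    exists2 M, recursive_learner M & weakly_confidently_learns H M C].

(* Main.v *)
(* By induction on programs, the graph of a program with oracle [A] belongs to
   every class of predicates which contains the computable ones, [A] and its
   complement, and is closed under conjunction, bounded universal and unbounded
   existential quantification. Hence the halting problem is Sigma_1 and its jump
   K' is Sigma_2, and no machine simulating another one is needed.

   One-one numbering: a Sigma_2 predicate has unique Pi_1 witnesses, so that
   every [a_(n+1)] with n in K' is enumerated by exactly one index that is never
   refuted; a refuted index turns into a large A_m.

   Learnability: let x be the least number that appears to be least in its class
   and does not occur in the data. If the content of the text lies in a member of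
   the class, x converges to the least a_m outside of the content, and the union
   of the classes of all y < x is A_m. For m = 0 one takes instead the class of
   the first datum.

   No class-preserving learner: n is not in K' iff there is a stabilizing
   sequence of the learner in [a_(n+1)] whose hypothesis is ? or a set that
   contains 0 or omits a_(n+1); indeed [a_(n+1)] is the only set that contains
   a_(n+1) but not 0 and can be a member of the class. This makes the complement
   of K' Sigma_2, hence r.e. in K, which is impossible. *)
Require Import Defs.
From Stdlib Require Import Cantor.
From mathcomp Require Import all_boot zify.
From mathcomp Require Import boolp classical_sets functions cardinality.

Set Implicit Arguments.
Unset Strict Implicit.
Unset Printing Implicit Defensive.

Local Open Scope classical_set_scope.

(** * Cantor pairing *)

Lemma nfstE x y : nfst (npair x y) = x.
Proof. by rewrite /nfst /npair Cantor.cancel_of_to. Qed.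

Lemma nsndE x y : nsnd (npair x y) = y.
Proof. by rewrite /nsnd /npair Cantor.cancel_of_to. Qed.

Lemma npairK z : npair (nfst z) (nsnd z) = z.
Proof.
by rewrite /npair /nfst /nsnd -surjective_pairing Cantor.cancel_to_of.
Qed.

Definition npE := (nfstE, nsndE, npairK).

Lemma leq_npair x y : x + y <= npair x y.
Proof. by have := Cantor.to_nat_non_decreasing x y; rewrite /npair; lia. Qed.

Lemma leq_nfst z : nfst z <= z.
Proof. by have := leq_npair (nfst z) (nsnd z); rewrite npairK; lia. Qed.

Lemma leq_nsnd z : nsnd z <= z.
Proof. by have := leq_npair (nfst z) (nsnd z); rewrite npairK; lia. Qed.

Lemma npair_inj x y x' y' : npair x y = npair x' y' -> x = x' /\ y = y'.
Proof.
by move=> e; split; [have := congr1 nfst e|have := congr1 nsnd e]; rewrite !npE.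
Qed.

(** * Computable functions *)

(** One program serves all oracles, so that it can also be used inside programs with oracle [K]. *)
Definition computable (f : nat -> nat) : Prop :=
  exists c, forall A x y, eval A c x y <-> y = f x.

Definition computable2 (f : nat -> nat -> nat) : Prop :=
  computable (fun z => f (nfst z) (nsnd z)).

Lemma computable_recursive f : computable f -> recursive f.
Proof. by move=> [c hc]; exists c => x y; split=> /hc. Qed.

(** Every oracle query is answered by 0, as the empty oracle would do. *)
Fixpoint strip (c : code) : code :=
  match c with
  | COracle => CZero
  | CPair d e => CPair (strip d) (strip e)
  | CComp d e => CComp (strip d) (strip e)
  | CPrec d e => CPrec (strip d) (strip e)
  | CMu d => CMu (strip d)
  | c => c
  end.

Lemma eval_strip A c : forall x y, eval A (strip c) x y = eval set0 c x y.
Proof.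
elim: c => //= [x y|d IHd e IHe x y|d IHd e IHe x y|d IHd e IHe x y|d IHd x y].
- by rewrite asboolF.
- by apply/propext; split=> -[u [v [h1 h2 ->]]]; exists u, v;
  rewrite ?IHd ?IHe in h1 h2 *.
- by apply/propext; split=> -[u h1 h2]; exists u; rewrite ?IHd ?IHe in h1 h2 *.
- elim: (nsnd x) y => [|m IH] y //.
  by apply/propext; split=> -[s h1 h2]; exists s; rewrite ?IH ?IHe in h1 h2 *.
- rewrite IHd; apply/propext; split=> -[h1 h2]; split=> // m /h2 [k];
  by rewrite ?IHd => hk; exists k; rewrite ?IHd.
Qed.

Lemma recursive_computable f : recursive f -> computable f.
Proof.
by move=> [c hc]; exists (strip c) => A x y; rewrite eval_strip; split=> /hc.
Qed.

Lemma computable_ext f g : computable f -> f =1 g -> computable g.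
Proof. by move=> [c hc] fg; exists c => A x y; rewrite -fg; apply: hc. Qed.

Lemma computable_comp f g :
  computable f -> computable g -> computable (fun x => f (g x)).
Proof.
move=> [c hc] [d hd]; exists (CComp c d) => A x y /=; split.
  by move=> [u /hd -> /hc].
by move=> ->; exists (g x); [apply/hd|apply/hc].
Qed.

Lemma computable_id : computable (fun x => x).
Proof.
exists (CPair CFst CSnd) => A x y /=; split.
  by move=> [u [v [-> -> ->]]]; rewrite npairK.
by move=> ->; exists (nfst x), (nsnd x); rewrite npairK.
Qed.

Lemma computable_succ f : computable f -> computable (fun x => (f x).+1).
Proof. by apply: computable_comp; exists CSucc. Qed.

Lemma computable_fst f : computable f -> computable (fun x => nfst (f x)).
Proof. by apply: computable_comp; exists CFst. Qed.

Lemma computable_snd f : computable f -> computable (fun x => nsnd (f x)).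
Proof. by apply: computable_comp; exists CSnd. Qed.

Lemma computable_cst n : computable (fun=> n).
Proof. by elim: n => [|n]; [exists CZero|apply: computable_succ]. Qed.

Lemma computable_pair f g :
  computable f -> computable g -> computable (fun x => npair (f x) (g x)).
Proof.
move=> [c hc] [d hd]; exists (CPair c d) => A x y /=; split.
  by move=> [u [v [/hc -> /hd -> ->]]].
by move=> ->; exists (f x), (g x); split=> //; [apply/hc|apply/hd].
Qed.

Lemma computable2_app F f g : computable2 F -> computable f -> computable g ->
  computable (fun x => F (f x) (g x)).
Proof.
move=> hF hf hg; have := computable_comp hF (computable_pair hf hg).
by move/computable_ext; apply=> x; rewrite !npE.
Qed.

Lemma computable_nat_rect (g : nat -> nat) (h : nat -> nat -> nat -> nat) n :
  computable g ->
  computable (fun z => h (nfst z) (nfst (nsnd z)) (nsnd (nsnd z))) ->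
  computable n ->
  computable (fun x => nat_rect (fun=> nat) (g x) (h x) (n x)).
Proof.
move=> [c hc] [d hd] hn.
have hrec : computable (fun z => nat_rect (fun=> nat) (g (nfst z)) (h (nfst z))
  (nsnd z)).
  exists (CPrec c d) => A x y /=; elim: (nsnd x) y => [|m IH] y /=;
    first exact: hc.
  split=> [[s /IH -> /hd]|->]; first by rewrite !npE.
  by eexists; [apply/IH; reflexivity|apply/hd; rewrite !npE].
have := computable_comp hrec (computable_pair computable_id hn).
by move/computable_ext; apply=> x; rewrite !npE.
Qed.

Lemma computable_iter F n g : computable2 F -> computable n -> computable g ->
  computable (fun x => iter (n x) (F x) (g x)).
Proof.
move=> hF hn hg.
apply: (@computable_nat_rect g (fun x _ => F x)) => //.
apply: (computable2_app hF).
  exact/computable_fst/computable_id.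
exact/computable_snd/computable_snd/computable_id.
Qed.

Lemma computable_pred f : computable f -> computable (fun x => (f x).-1).
Proof.
move=> hf; suff : computable (fun x => nat_rect (fun=> nat) 0 (fun m _ => m) (f
  x)).
  by move/computable_ext; apply=> x; case: (f x).
apply: (@computable_nat_rect (fun=> 0) (fun _ m _ => m)) => //.
  exact: computable_cst.
exact/computable_fst/computable_snd/computable_id.
Qed.

Lemma computable_add f g :
  computable f -> computable g -> computable (fun x => f x + g x).
Proof.
move=> hf hg; suff : computable (fun x => iter (f x) succn (g x)).
  by move/computable_ext; apply=> x; rewrite iter_succn addnC.
apply: (@computable_iter (fun=> succn)) => //.
exact/computable_succ/computable_snd/computable_id.
Qed.

Lemma computable_sub f g :
  computable f -> computable g -> computable (fun x => f x - g x).
Proof.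
move=> hf hg; suff : computable (fun x => iter (g x) predn (f x)).
  by move/computable_ext; apply=> x; rewrite iter_predn.
apply: (@computable_iter (fun=> predn)) => //.
exact/computable_pred/computable_snd/computable_id.
Qed.

Lemma computable_if (p : nat -> bool) f g :
  computable p -> computable f -> computable g ->
  computable (fun x => if p x then f x else g x).
Proof.
move=> hp hf hg.
suff : computable (fun x => nat_rect (fun=> nat) (g x) (fun _ _ => f x) (p x)).
  by move/computable_ext; apply=> x; case: (p x).
apply: (@computable_nat_rect g (fun x _ _ => f x)) => //.
exact/computable_comp/computable_fst/computable_id.
Qed.

Lemma computable_not (p : nat -> bool) :
  computable p -> computable (fun x => ~~ p x).
Proof.
move=> hp; apply: (computable_ext (f := fun x => if p x then 0 else 1)).
  by apply: computable_if => //; exact: computable_cst.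
by move=> x; case: (p x).
Qed.

Lemma computable_and (p q : nat -> bool) :
  computable p -> computable q -> computable (fun x => p x && q x).
Proof.
move=> hp hq; apply: (computable_ext (f := fun x => if p x then q x : nat else
  0)).
  by apply: computable_if => //; exact: computable_cst.
by move=> x; case: (p x).
Qed.

Lemma computable_or (p q : nat -> bool) :
  computable p -> computable q -> computable (fun x => p x || q x).
Proof.
move=> hp hq; apply: (computable_ext (f := fun x => if p x then 1 else q x :
  nat)).
  by apply: computable_if => //; exact: computable_cst.
by move=> x; case: (p x).
Qed.

Lemma computable_leq f g :
  computable f -> computable g -> computable (fun x => f x <= g x : nat).
Proof.
move=> hf hg.
have h0 : computable (fun x => nat_rect (fun=> nat) 1 (fun _ _ => 0) (f x - g
  x)).
  apply: (@computable_nat_rect (fun=> 1) (fun _ _ _ => 0));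
  by [exact: computable_cst|exact: computable_sub].
by apply: (computable_ext h0) => x; rewrite /leq; case: (f x - g x).
Qed.

Lemma computable_eq f g :
  computable f -> computable g -> computable (fun x => f x == g x : nat).
Proof.
move=> hf hg; apply: (computable_ext (f := fun x => (f x <= g x) && (g x <= f
  x))).
  by apply: computable_and; apply: computable_leq.
by move=> x; rewrite eqn_leq.
Qed.

(** * Bounded search *)

Lemma iota0S m : iota 0 m.+1 = rcons (iota 0 m) m.
Proof. by rewrite -addn1 iotaD cats1. Qed.

Lemma computable_find (p : nat -> nat -> bool) n :
  computable2 (fun x i => p x i) -> computable n ->
  computable (fun x => find (p x) (iota 0 (n x))).
Proof.
move=> hp hn.
(* After [m] steps the value [r] is less than [m] if the search has succeeded, and equal to [m]
   otherwise. *)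
suff : computable (fun x => nat_rect (fun=> nat) 0
    (fun m r => if r < m then r else if p x m then m else m.+1) (n x)).
  move/computable_ext; apply=> x; elim: (n x) => [|m IH] //.
  rewrite iota0S -cats1 find_cat [LHS]/= IH has_find size_iota /=.
  case: ltnP => // hm; case: (p x m) => //; rewrite ?addn0 ?addn1 //.
apply: (@computable_nat_rect (fun=> 0)
  (fun x m r => if r < m then r else if p x m then m else m.+1)) => //.
  exact: computable_cst.
have hm : computable (fun z => nfst (nsnd z)).
  exact/computable_fst/computable_snd/computable_id.
have hr : computable (fun z => nsnd (nsnd z)).
  exact/computable_snd/computable_snd/computable_id.
apply: computable_if => //.
  by apply: computable_leq => //; exact: computable_succ.
apply: computable_if => //; last exact: computable_succ.
by apply: (computable2_app hp) => //; exact/computable_fst/computable_id.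
Qed.

Lemma computable_all (p : nat -> nat -> bool) n :
  computable2 (fun x i => p x i) -> computable n ->
  computable (fun x => all (p x) (iota 0 (n x))).
Proof.
move=> hp hn.
have hf := computable_find (p := fun x i => ~~ p x i) (computable_not hp) hn.
apply: (computable_ext (computable_eq hf hn)) => x.
rewrite -(negbK (all _ _)) -has_predC has_find size_iota -leqNgt.
by have := find_size (predC (p x)) (iota 0 (n x));
  rewrite size_iota eqn_leq => ->.
Qed.
(* Finite sequences are coded as right-nested pairs [<x0, <x1, <x2, ...>>>],
   so that every number codes an infinite sequence. *)
Definition entry (l i : nat) : nat := nfst (iter i nsnd l).

Lemma computable_entry f g :
  computable f -> computable g -> computable (fun x => entry (f x) (g x)).
Proof.
move=> hf hg; apply: computable_fst;
  apply: (computable_iter (F := fun=> nsnd)) => //.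
exact/computable_snd/computable_snd/computable_id.
Qed.

(* The code of the list coded by [z] without its first [i] entries. *)
Definition drop_code (z i : nat) : nat := iter i (fun u => nsnd u.-1) z.

(* The code of the [i]-th entry of the list coded by [z]; it is [0] both for a
   pause symbol and beyond the end of the list. *)
Definition item (z i : nat) : nat := nfst (drop_code z i).-1.

Lemma computable_drop_code f g :
  computable f -> computable g -> computable (fun x => drop_code (f x) (g x)).
Proof.
move=> hf hg; apply: (computable_iter (F := fun _ u => nsnd u.-1)) => //.
exact/computable_snd/computable_pred/computable_snd/computable_id.
Qed.

Lemma computable_item f g :
  computable f -> computable g -> computable (fun x => item (f x) (g x)).
Proof.
by move=> hf hg; apply/computable_fst/computable_pred/computable_drop_code.
Qed.

Ltac computability :=
  cbv beta; lazymatch goal with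
  | |- computable2 _ => unfold computable2; computability
  | |- computable (fun x => x) => exact computable_id
  | |- computable nfst => exact (computable_fst computable_id)
  | |- computable nsnd => exact (computable_snd computable_id)
  | |- computable (fun _ => ?c) => exact (computable_cst c)
  | |- computable (fun x => nfst _) => apply computable_fst; computability
  | |- computable (fun x => nsnd _) => apply computable_snd; computability
  | |- computable (fun x => S _) => apply computable_succ; computability
  | |- computable (fun x => npair _ _) =>
      apply computable_pair; computability
  | |- computable (fun x => predn _) => apply computable_pred; computability
  | |- computable (fun x => addn _ _) => apply computable_add; computability
  | |- computable (fun x => entry _ _) => apply computable_entry; computability
  | |- computable (fun x => drop_code _ _) =>
      apply computable_drop_code; computability
  | |- computable (fun x => item _ _) => apply computable_item; computability
  | |- computable (fun x => iter _ _ _) => apply computable_iter; computability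
  | |- computable (fun x => find _ (iota 0 _)) =>
      apply computable_find; computability
  | |- computable (fun x => nat_of_bool (all _ (iota 0 _))) =>
      apply computable_all; computability
  | |- computable (fun x => nat_of_bool (~~ _)) =>
      apply computable_not; computability
  | |- computable (fun x => nat_of_bool (_ && _)) =>
      apply computable_and; computability
  | |- computable (fun x => nat_of_bool (_ || _)) =>
      apply computable_or; computability
  | |- computable (fun x => nat_of_bool (leq _ _)) =>
      apply computable_leq; computability
  | |- computable (fun x => nat_of_bool (_ == _)) =>
      apply computable_eq; computability
  | |- computable (fun x => if _ then _ else _) =>
      apply computable_if; computability
  | H : computable2 ?F |- computable (fun x => ?F _ _) =>
      apply (computable2_app H); computability
  | H : computable2 (fun x y => nat_of_bool (?F x y))
      |- computable (fun x => nat_of_bool (?F _ _)) =>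
      apply (computable2_app H); computability
  | H : computable ?f |- computable ?f => exact H
  | H : computable (fun x => nat_of_bool (?f x))
      |- computable (fun x => nat_of_bool (?f _)) =>
      apply (computable_comp H); computability
  | H : computable ?f |- computable (fun x => ?f _) =>
      apply (computable_comp H); computability
  end.

(** * Classes of arithmetical predicates *)

Lemma entry_npair0 x l : entry (npair x l) 0 = x.
Proof. by rewrite /entry /= nfstE. Qed.

Lemma entry_npairS x l i : entry (npair x l) i.+1 = entry l i.
Proof. by rewrite /entry iterSr nsndE. Qed.

(** The tail is set to 0, so that a code is determined by its entries; this will make witnesses
    unique. *)
Lemma sequence_code (h : nat -> nat) n :
  exists l, (forall i, i < n -> entry l i = h i) /\ iter n nsnd l = 0.
Proof.
elim: n h => [|n IH] h; first by exists 0.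
have [l [hl l0]] := IH (h \o succn); exists (npair (h 0) l); split.
  by case=> [|i] hi; rewrite ?entry_npair0 ?entry_npairS // hl.
by rewrite iterSr nsndE.
Qed.

Lemma sequence_code_inj n l l' :
  (forall i, i < n -> entry l i = entry l' i) ->
  iter n nsnd l = iter n nsnd l' -> l = l'.
Proof.
elim: n l l' => [|n IH] l l' // hE; rewrite !iterSr => ht.
rewrite -(npairK l) -(npairK l'); congr npair; first exact: (hE 0).
by apply: IH => // i hi; have := hE i.+1 hi; rewrite /entry !iterSr.
Qed.

Definition computable_set (P : nat -> Prop) : Prop :=
  exists2 p : nat -> bool, computable (fun x => p x) & P = fun x => is_true (p
    x).

(** These properties hold for the computable predicates and for the complements of a [closed_class],
    so that [Sigma] can be iterated. *)
Record base_class (G : (nat -> Prop) -> Prop) : Prop := BaseClass {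
  base_dec : forall P, computable_set P -> G P;
  base_sub : forall P f, G P -> computable f -> G (fun x => P (f x));
  base_and : forall P Q, G P -> G Q -> G (fun x => P x /\ Q x);
  base_all : forall P n, G (fun z => P (nfst z) (nsnd z)) -> computable n ->
    G (fun x => forall i, i < n x -> P x i)
}.

Record closed_class (G : (nat -> Prop) -> Prop) : Prop := ClosedClass {
  closed_base : base_class G;
  closed_ex : forall P, G (fun z => P (nfst z) (nsnd z)) ->
    G (fun x => exists y, P x y)
}.

Definition Sigma (G : (nat -> Prop) -> Prop) (P : nat -> Prop) : Prop :=
  exists2 Q : nat -> Prop, G Q & P = fun x => exists p, Q (npair x p).

Definition Pi (G : (nat -> Prop) -> Prop) (P : nat -> Prop) : Prop :=
  G (fun x => ~ P x).

Lemma class_ext (G : (nat -> Prop) -> Prop) P Q :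
  G P -> (forall x, P x <-> Q x) -> G Q.
Proof.
by move=> hP PQ; suff -> : Q = P by []; apply/funext => x; apply/propext;
  split=> /PQ.
Qed.

Lemma computable_set_base : base_class computable_set.
Proof.
split=> //.
- by move=> _ f [p hp ->] hf; exists (fun x => p (f x)) => //; computability.
- move=> _ _ [p hp ->] [q hq ->]; exists (fun x => p x && q x);
  first by computability.
  by apply/funext => x; apply/propext; split=> /andP.
- move=> P n [p hp /(congr1 (fun F => F \o (fun u => npair u.1 u.2))) pE] hn.
  exists (fun x => all (fun i => p (npair x i)) (iota 0 (n x)));
    first by computability.
  apply/funext => x; apply/propext.
  have PE i : P x i = p (npair x i).
    by have := congr1 (@^~ (x, i)) pE; rewrite /= !npE.
  split=> [h|/allP h i hi]; last by rewrite PE h // mem_iota.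
  by apply/allP => i; rewrite mem_iota /= add0n -PE => /h.
Qed.

Lemma Sigma_closed G : base_class G -> closed_class (Sigma G).
Proof.
move=> bG; split; first split.
- move=> P [p hp ->]; exists (fun z => p (nfst z)).
    by apply: (base_dec bG); exists (fun z => p (nfst z)) => //; computability.
  by apply/funext => x; apply/propext; split=> [h|[y]]; [exists 0|];
    rewrite !npE.
- move=> _ f [Q hQ ->] hf; exists (fun z => Q (npair (f (nfst z)) (nsnd z))).
    by apply: (base_sub bG (P := Q)) => //; computability.
  by apply/funext => x; apply/propext; split=> -[y hy]; exists y;
    rewrite !npE in hy *.
- move=> _ _ [P hP ->] [Q hQ ->].
  exists (fun z => P (npair (nfst z) (nfst (nsnd z))) /\
                   Q (npair (nfst z) (nsnd (nsnd z)))).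
    by apply: (base_and bG); apply: (base_sub bG) => //; computability.
  apply/funext => x; apply/propext; split=> [[[y hy] [y' hy']]|[y]].
    by exists (npair y y'); rewrite !npE.
  by rewrite !npE => -[h h']; split; [exists (nfst y)|exists (nsnd y)].
- move=> P n [Q hQ /(congr1 (fun F => F \o (fun u => npair u.1 u.2))) PQ] hn.
  have PE x i : P x i = exists p, Q (npair (npair x i) p).
    by have := congr1 (@^~ (x, i)) PQ; rewrite /= !npE.
  (* The witnesses for all [i < n x] are collected in one coded sequence. *)
  exists (fun z => forall i, i < n (nfst z) ->
    Q (npair (npair (nfst z) i) (entry (nsnd z) i))).
    apply: (base_all bG (n := fun z => n (nfst z))); last by computability.
    apply: (base_sub bG (P := Q)) => //.
    by apply: computable_pair; [|apply: computable_entry]; computability.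
  apply/funext => x; apply/propext; split=> [h|[l hl] i hi].
    have hs i : exists p, i < n x -> Q (npair (npair x i) p).
      case: (ltnP i (n x)) => [hi|]; last by exists 0.
      by move: (h i hi); rewrite PE => -[p]; exists p.
    have [s {}hs] := choice hs; have [l [hl _]] := sequence_code s (n x).
    by exists l => i; rewrite !npE => hi; rewrite hl //; apply: hs.
  by rewrite PE; exists (entry l i); have := hl i; rewrite !npE; apply.
- move=> P [Q hQ /(congr1 (fun F => F \o (fun u => npair u.1 u.2))) PQ].
  have PE x i : P x i = exists p, Q (npair (npair x i) p).
    by have := congr1 (@^~ (x, i)) PQ; rewrite /= !npE.
  exists (fun z => Q (npair (npair (nfst z) (nfst (nsnd z))) (nsnd (nsnd z)))).
    by apply: (base_sub bG (P := Q)) => //; computability.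
  apply/funext => x; apply/propext; split=> [[y]|[w hw]].
    by rewrite PE => -[p hp]; exists (npair y p); rewrite !npE.
  by exists (nfst w); rewrite PE; exists (nsnd w); rewrite !npE in hw.
Qed.

Section Closure.
Variables (G : (nat -> Prop) -> Prop) (cG : closed_class G).
Let bG := closed_base cG.

Lemma closed_dec (p : nat -> bool) : computable (fun x => p x) -> G (fun x => p
  x).
Proof. by move=> hp; apply: (base_dec bG); exists p. Qed.

Lemma closed_eq f g : computable f -> computable g -> G (fun x => f x = g x).
Proof.
move=> hf hg; apply: (class_ext (P := fun x => f x == g x)).
  by apply: closed_dec; computability.
by move=> x; split=> /eqP.
Qed.

Lemma closed_app2 (P : nat -> nat -> Prop) f g :
  G (fun z => P (nfst z) (nsnd z)) -> computable f -> computable g ->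
  G (fun x => P (f x) (g x)).
Proof.
move=> hP hf hg; apply: (class_ext (base_sub bG hP (computable_pair hf hg))) =>
  x.
by rewrite !npE.
Qed.

(* The selector [y] makes one of the two bounded quantifiers vacuous. *)
Lemma closed_or P Q : G P -> G Q -> G (fun x => P x \/ Q x).
Proof.
move=> hP hQ; apply: (class_ext (P := fun x => exists y,
    (forall i, i < ~~ (y == 0) -> P x) /\ (forall i, i < (y == 0) -> Q x))).
  apply: (closed_ex cG); apply: (base_and bG).
    apply: (base_all bG (P := fun z _ => P (nfst z)) (n := fun z => ~~ (nsnd z
      == 0))).
      by apply: (base_sub bG (P := P)) => //; computability.
    by computability.
  apply: (base_all bG (P := fun z _ => Q (nfst z)) (n := fun z => nsnd z == 0)).
    by apply: (base_sub bG (P := Q)) => //; computability.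
  by computability.
move=> x; split=> [[y [h1 h2]]|[h|h]]; last 2 first.
- by exists 1.
- by exists 0.
by case: (eqVneq y 0) h1 h2 => [_ _ /(_ 0 isT)|_ /(_ 0 isT)]; [right|left].
Qed.

Lemma closed_bex P n : G (fun z => P (nfst z) (nsnd z)) -> computable n ->
  G (fun x => exists i, i < n x /\ P x i).
Proof.
move=> hP hn; apply: (closed_ex cG (P := fun x i => i < n x /\ P x i)).
by apply: (base_and bG) => //; apply: closed_dec; computability.
Qed.

(** Induction on the program. The complement of [A] handles the oracle answer 0; bounded
    quantification handles traces of recursions and the values below a minimum. *)
Lemma closed_eval A c : G A -> G (fun x => ~ A x) ->
  G (fun z => eval A c (nfst z) (nsnd z)).
Proof.
move=> hA hN; elim: c => /= [|||||d IHd e IHe|d IHd e IHe|d IHd e IHe|d IHd].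
- by apply: closed_eq; computability.
- by apply: closed_eq; computability.
- by apply: closed_eq; computability.
- by apply: closed_eq; computability.
- apply: (class_ext (P := fun z =>
    (A (nfst z) /\ nsnd z = 1) \/ (~ A (nfst z) /\ nsnd z = 0))).
    apply: closed_or; apply: (base_and bG); try by apply: closed_eq;
      computability.
      by apply: (base_sub bG (P := A)) => //; computability.
    by apply: (base_sub bG (P := fun x => ~ A x)) => //; computability.
  move=> x; case: asboolP => h /=; split=> [[[] //|[] //]|].
    by left.
  by right.
- apply: (closed_ex cG); apply: (closed_ex cG).
  apply: (class_ext (P := fun w =>
    let u := nsnd (nfst w) in let v := nsnd w in let z := nfst (nfst w) in
    [/\ eval A d (nfst z) u /\ eval A e (nfst z) v & nsnd z = npair u v])).
    apply: (class_ext (P := fun w =>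
    (let u := nsnd (nfst w) in let v := nsnd w in let z := nfst (nfst w) in
    (eval A d (nfst z) u /\ eval A e (nfst z) v) /\ nsnd z = npair u v))) =>
      //=.
    apply: (base_and bG); last by apply: closed_eq; computability.
    by apply: (base_and bG); apply: closed_app2 => //; computability.
  by move=> x /=; split=> [[[? ?] ?]|[? ? ?]].
- apply: (class_ext (P := fun z => exists u, eval A e (nfst z) u /\ eval A d u
  (nsnd z))).
    apply: (closed_ex cG); apply: (base_and bG); apply: closed_app2 => //;
      by computability.
  by move=> x; split=> [[u []]|[u]]; exists u.
- (* a trace of the values of the recursion *)
  apply: (class_ext (P := fun z => exists l,
     eval A d (nfst (nfst z)) (entry l 0) /\
     ((forall m, m < nsnd (nfst z) ->
        eval A e (npair (nfst (nfst z)) (npair m (entry l m))) (entry l m.+1))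
          /\
     nsnd z = entry l (nsnd (nfst z))))).
    apply: (closed_ex cG); apply: (base_and bG).
      apply: closed_app2 => //; first by computability.
      by apply: computable_entry; computability.
    apply: (base_and bG); last first.
      by apply: closed_eq; [|apply: computable_entry]; computability.
    apply: (base_all bG (n := fun z => nsnd (nfst (nfst z))));
      last by computability.
    have hE k : computable k -> computable (fun w => entry (nsnd (nfst w)) (k
      w)).
      by move=> hk; apply: computable_entry; computability.
    apply: closed_app2 => //; last by apply: hE; computability.
    do 2![apply: computable_pair; first by computability].
    by apply: hE; computability.
  move=> z; move: (nfst z) (nsnd z) => x y; elim: (nsnd x) y => [|n IH] y.
    split=> [[l [h0 [_ ->]]] //|h]; exists (npair y 0).
    by rewrite entry_npair0; split.
  split=> [[l [h0 [hS ->]]]|[s]].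
    exists (entry l n); last exact: hS.
    by apply/IH; exists l; split=> //; split=> // m hm; apply: hS; exact: ltnW.
  move=> /IH [l [h0 [hS sE]]] hy.
  have [l' [hl' _]] := sequence_code (fun i => if i <= n then entry l i else y)
    n.+2.
  exists l'; rewrite !hl' //= ltnn; split=> //; split=> // m hm.
  rewrite !hl' ?(leqW hm) // -ltnS hm.
  case: ltnP => [hm'|hm']; first exact: hS.
  have -> : m = n by lia.
  by rewrite -sE.
- apply: (base_and bG).
    by apply: closed_app2 => //; computability.
  apply: (base_all bG (n := fun z => nsnd z)); last by computability.
  apply: (closed_ex cG); apply: closed_app2 => //; by computability.
Qed.

Lemma closed_set0 : G set0 /\ G (fun x => ~ set0 x).
Proof.
split.
  by apply: (class_ext (closed_dec (p := fun=> false) _)) => //; computability.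
apply: (class_ext (closed_dec (p := fun=> true) _)); first by computability.
by move=> x; split=> // _ [].
Qed.

(** Complementation turns disjunction and bounded existential quantification in [G] into conjunction
    and bounded universal quantification. *)
Lemma Pi_base : base_class (Pi G).
Proof.
split; rewrite /Pi.
- move=> _ [p hp ->]; apply: (class_ext (P := fun x => ~~ p x)).
    by apply: closed_dec; computability.
  by move=> x; split=> /negP.
- by move=> P f hP hf; apply: (base_sub bG hP).
- move=> P Q hP hQ; apply: (class_ext (closed_or hP hQ)) => x.
  by split=> /not_andP.
- move=> P n hP hn.
  apply: (class_ext (closed_bex (P := fun x y => ~ P x y) hP hn)) => x.
  split=> [[i [hi h]] /(_ i hi) //|/existsNP [i /not_implyP [hi h]]].
  by exists i.
Qed.

End Closure.

(** * The first two levels of the arithmetical hierarchy *)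

Notation Sigma1 := (Sigma computable_set).
Notation Sigma2 := (Sigma (Pi Sigma1)).

Definition Sigma1_closed := Sigma_closed computable_set_base.
Definition Sigma2_closed := Sigma_closed (Pi_base Sigma1_closed).

Lemma Sigma_base G P : base_class G -> G P -> Sigma G P.
Proof.
move=> bG hP; exists (fun z => P (nfst z)).
  by apply: (base_sub bG hP); computability.
by apply/funext => x; apply/propext; split=> [h|[p]]; [exists 0|]; rewrite !npE.
Qed.

Lemma Pi1_Sigma2 P : Sigma1 P -> Sigma2 (fun x => ~ P x).
Proof.
move=> hP; apply: (Sigma_base (Pi_base Sigma1_closed)).
by apply: (class_ext hP) => x; split=> [? []|/contrapT].
Qed.

Lemma Sigma1_Sigma2 P : Sigma1 P -> Sigma2 P.
Proof.
move=> [Q hQ ->]; exists Q => //.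
exact: (base_dec (Pi_base Sigma1_closed) hQ).
Qed.

Lemma Sigma1_re P : Sigma1 P -> re P.
Proof.
(* Minimization searches for the value 0, hence the negation of [p]. *)
move=> [_ [p hp ->] ->]; have [c hc] := computable_not hp.
exists (eval set0 (CMu c)); first by exists (CMu c).
apply/funext => x; apply/propext; split=> [[y hy]|[y [/hc + _]]]; last first.
  by case E: (p (npair x y)) => // _; exists y.
have [m hm mmin] := ex_minnP (ex_intro (fun y => p (npair x y)) y hy).
exists m => /=; split=> [|k hk]; first by apply/hc; rewrite hm.
exists 0; apply/hc; case E: (p (npair x k)) => //.
by have := mmin _ E; rewrite leqNgt hk.
Qed.

Lemma re_Sigma1 P : re P -> Sigma1 P.
Proof.
move=> [f [c hc] ->]; apply: (class_ext (P := fun x => exists y, eval set0 c x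
  y)).
  have [h0 h0'] := closed_set0 Sigma1_closed.
  by apply: (closed_ex Sigma1_closed); apply: (closed_eval Sigma1_closed).
by move=> x /=; split=> -[y hy]; exists y; apply/hc.
Qed.

(** Reads the complexity off the shape of a formula; under [Sigma2] a negation leads back to
    [Sigma1]. *)
Ltac arithmeticity cG :=
  cbv beta; lazymatch goal with
  | |- _ (fun x => exists y, _) => apply (closed_ex cG); arithmeticity cG
  | |- _ (fun x => _ /\ _) =>
      apply (base_and (closed_base cG)); arithmeticity cG
  | |- _ (fun x => _ \/ _) => apply (closed_or cG); arithmeticity cG
  | |- _ (fun x => forall i, is_true (i < _) -> _) =>
      apply (base_all (closed_base cG)); [arithmeticity cG|computability]
  | |- _ (fun x => is_true _) => apply (closed_dec cG); computability
  | |- _ (fun x => @eq nat _ _) => apply (closed_eq cG); computability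
  | |- Sigma2 (fun x => ~ _) => apply Pi1_Sigma2; arithmeticity Sigma1_closed
  | H : ?G (fun z => ?P (nfst z) (nsnd z)) |- ?G (fun x => ?P _ _) =>
      apply (closed_app2 cG H); computability
  | H : Sigma1 (fun z => ?P (nfst z) (nsnd z)) |- Sigma2 (fun x => ?P _ _) =>
      apply Sigma1_Sigma2; apply (closed_app2 Sigma1_closed H); computability
  | H : ?G ?P |- ?G (fun x => ?P _) =>
      apply (base_sub (closed_base cG) H); computability
  end.

(* The unique witness consists of the least [p] such that no [t] refutes [p],
   together with the least refutations of the smaller numbers. *)
Lemma Sigma2_unique_witness P : Sigma2 P ->
  exists2 F : nat -> nat -> bool, computable2 (fun k t => F k t) &
    (forall x, P x <-> exists w, forall t, ~~ F (npair x w) t) /\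
    (forall x w w', (forall t, ~~ F (npair x w) t) ->
       (forall t, ~~ F (npair x w') t) -> w = w').
Proof.
move=> [Q [_ [r hr ->] QE] ->].
have {}QE z : Q z <-> forall t, ~~ r (npair z t).
  have := congr1 (@^~ z) QE => /= E; split=> [h t|h].
    by apply/negP => ht; suff : ~ Q z by []; rewrite E; exists t.
  by apply: contrapT; rewrite E => -[t]; apply/negP.
(* For [k = <x, <p, l>>] the disjuncts say that [t] refutes [p], that one of the first [p] entries
   of [l] is not the least refutation of its position, or that [l] has a nonzero tail. Only the
   first depends on [t]. *)
pose F k t := r (npair (npair (nfst k) (nfst (nsnd k))) t) ||
  ~~ (all (fun i => r (npair (npair (nfst k) i) (entry (nsnd (nsnd k)) i)) &&
  all (fun q => ~~ r (npair (npair (nfst k) i) q)) (iota 0 (entry (nsnd (nsnd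
    k)) i)))
    (iota 0 (nfst (nsnd k)))) ||
  ~~ (iter (nfst (nsnd k)) nsnd (nsnd (nsnd k)) == 0).
have FE x p l : (forall t, ~~ F (npair x (npair p l)) t) <->
    [/\ Q (npair x p), iter p nsnd l = 0 &
      forall i, i < p -> r (npair (npair x i) (entry l i)) /\
        forall q, q < entry l i -> ~~ r (npair (npair x i) q)].
  split=> [h|[h1 h2 h3] t].
    split; first by apply/QE => t; have := h t;
      rewrite /F !npE !negb_or => /andP[/andP[]].
      by have := h 0; rewrite /F !npE !negb_or !negbK => /andP[_ /eqP].
    have := h 0; rewrite /F !npE !negb_or !negbK => /andP[/andP[_ /allP hi] _]
      i ip.
    have [|? /allP hq] := andP (hi i _); first by rewrite mem_iota.
    by split=> // q ql; apply: hq; rewrite mem_iota.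
  move/QE: h1 => h1; rewrite /F !npE !negb_or !negbK h1 h2 eqxx andbT.
  apply/allP => i; rewrite mem_iota => /h3 [-> hq].
  by apply/allP => q; rewrite mem_iota => /hq.
exists F; first by rewrite /F; computability.
split=> [x|x w w'].
  split=> [[p0 hp0]|[w]]; last first.
    by rewrite -(npairK w) => /FE [h _ _]; exists (nfst w).
  have [p /asboolP hp pmin] :=
    ex_minnP (ex_intro (fun p => `[< Q (npair x p) >]) p0 (asboolT hp0)).
  have hs i : exists q, i < p -> r (npair (npair x i) q) /\
      forall q', q' < q -> ~~ r (npair (npair x i) q').
    case: (ltnP i p) => hi; last by exists 0.
    have /QE/existsNP [t /negP] : ~ Q (npair x i).
      by move=> /asboolT /pmin; rewrite leqNgt hi.
    rewrite negbK => ht.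
    have [q hq qmin] := ex_minnP (ex_intro (fun q => r (npair (npair x i) q)) t
      ht).
    exists q => _; split=> // q' hq'; apply/negP => /qmin.
    by rewrite leqNgt hq'.
  have [s {}hs] := choice hs; have [l [hl l0]] := sequence_code s p.
  by exists (npair p l); apply/FE; split=> // i hi; rewrite hl //; apply: hs.
rewrite -(npairK w) -(npairK w').
move: (nfst w) (nsnd w) (nfst w') (nsnd w') => p l p' l' /FE [h1 h2 h3] /FE
  [h1' h2' h3'].
(* If [p < p'], then [l'] lists a refutation of [p], which is irrefutable; likewise conversely. *)
have pp : p = p'.
  case: (ltngtP p p') => // hp.
    by have [+ _] := h3' _ hp; move/QE: h1 => /(_ (entry l' p)) /negP.
  by have [+ _] := h3 _ hp; move/QE: h1' => /(_ (entry l p')) /negP.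
move: h1 h2 h3; rewrite pp => h1 h2 h3; congr npair.
apply: (sequence_code_inj (n := p')) => [i hi|]; last by rewrite h2 h2'.
have [hr1 hm1] := h3 i hi; have [hr2 hm2] := h3' i hi.
by case: (ltngtP (entry l i) (entry l' i)) => // [/hm2|/hm1]; rewrite ?hr1 ?hr2.
Qed.

(** * Texts and their codes *)

Lemma drop_code_encode_seq s i : drop_code (encode_seq s) i = encode_seq (drop
  i s).
Proof.
elim: i s => [|i IH] s; first by rewrite drop0.
rewrite /drop_code iterSr; case: s => [|o s] /=; last by rewrite nsndE -IH.
have -> : nsnd 0 = 0 by apply/eqP; rewrite -leqn0 leq_nsnd.
exact: (IH [::]).
Qed.

Lemma item_encode_seq s i : item (encode_seq s) i = encode_option (nth None s
  i).
Proof.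
rewrite /item drop_code_encode_seq -[in RHS](addn0 i) -nth_drop.
case: (drop i s) => [|o t] /=; last by rewrite nfstE.
by apply/eqP; rewrite -leqn0 leq_nfst.
Qed.

(** Allows the code itself to bound searches through the positions of a list. *)
Lemma size_encode_seq s : size s <= encode_seq s.
Proof.
by elim: s => //= o s IH; rewrite ltnS;
  have := leq_npair (encode_option o) (encode_seq s); lia.
Qed.

Lemma find_iota (p : pred nat) m k :
  (forall i, i < m -> ~~ p i) -> p m -> m < k -> find p (iota 0 k) = m.
Proof.
move=> hm pm mk; have hk : find p (iota 0 k) < k.
  by rewrite -{2}(size_iota 0 k) -has_find; apply/hasP; exists m;
    rewrite ?mem_iota.
apply/eqP; rewrite eqn_leq; apply/andP; split; rewrite leqNgt; apply/negP => h.
  by have := before_find 0 h; rewrite nth_iota ?(ltn_trans h) // pm.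
have := nth_find 0 (a := p) (s := iota 0 k);
  rewrite has_find size_iota => /(_ hk).
by rewrite nth_iota // (negbTE (hm _ h)).
Qed.

Lemma eventually_below (Q : nat -> nat -> Prop) m :
  (forall x, x < m -> exists N, forall n, N <= n -> Q x n) ->
  exists N, forall n, N <= n -> forall x, x < m -> Q x n.
Proof.
elim: m => [|m IH] h; first by exists 0.
have [N1 h1] := IH (fun x xm => h x (ltnW xm)); have [N2 h2] := h m (ltnSn m).
exists (maxn N1 N2) => n; rewrite geq_max => /andP[n1 n2] x.
by rewrite ltnS leq_eqVlt => /orP[/eqP ->|/h1]; [exact: h2|exact].
Qed.

Lemma item_mkseq (T : text) n i : i < n ->
  item (encode_seq (mkseq T n)) i = encode_option (T i).
Proof. by move=> hi; rewrite item_encode_seq nth_mkseq. Qed.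

Lemma leq_code_mkseq (T : text) n : n <= encode_seq (mkseq T n).
Proof. by apply: leq_trans (size_encode_seq _); rewrite size_mkseq. Qed.

(** The value is the successor of the datum. Without a datum [find] returns [z], which is beyond the
    end of the list, and the value is 0. *)
Definition first_datum (z : nat) : nat :=
  item z (find (fun i => ~~ (item z i == 0)) (iota 0 z)).

Lemma first_datum_converges (T : text) :
  exists d, (exists N, forall n, N <= n -> first_datum (encode_seq (mkseq T n))
    = d) /\
    ((d = 0 /\ content T = set0) \/ (0 < d /\ content T d.-1)).
Proof.
have [[i0 h0]|h] := pselect (exists i, T i != None); last first.
  have TN i : T i = None by apply/eqP/negPn/negP => hi; apply: h; exists i.
  exists 0; split; last by left; split=> //; apply/seteqP; split=> x // [i];
    rewrite TN.
  have zero n i : item (encode_seq (mkseq T n)) i = 0.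
    rewrite item_encode_seq; case: (ltnP i n) => hi;
      first by rewrite nth_mkseq ?TN.
    by rewrite nth_default // size_mkseq.
  by exists 0 => n _; rewrite /first_datum zero.
have [i hi imin] := ex_minnP (ex_intro (fun i => T i != None) i0 h0).
exists (encode_option (T i)); split; last first.
  by case E: (T i) hi => [x|] // _; right; split=> //; exists i.
exists i.+1 => n ni; rewrite /first_datum (@find_iota _ i) ?item_mkseq //.
- move=> j ji; rewrite item_mkseq ?(ltn_trans ji) // negbK.
  case E: (T j) => [x|] //; have := imin j; rewrite E => /(_ isT).
  by rewrite leqNgt ji.
- by case: (T i) hi.
- exact: leq_trans ni (leq_code_mkseq T n).
Qed.


Lemma drop_code_encode_seq_eq0 s i :
  (drop_code (encode_seq s) i == 0) = (size s <= i).
Proof.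
rewrite drop_code_encode_seq -subn_eq0 -size_drop.
by case: (drop i s).
Qed.

Lemma encode_option_surj n : exists o, encode_option o = n.
Proof. by case: n => [|n]; [exists None|exists (Some n)]. Qed.

Lemma encode_option_inj : injective encode_option.
Proof. by move=> [x|] [y|] //= [->]. Qed.

(** Lets number quantifiers range over all finite sequences. *)
Lemma encode_seq_surj z : exists s, encode_seq s = z.
Proof.
elim/ltn_ind: z => -[|z] IH; first by exists [::].
have [s sz] := IH (nsnd z) (leq_nsnd z);
  have [o oz] := encode_option_surj (nfst z).
by exists (o :: s); rewrite /= sz oz npairK.
Qed.

(** The end of a list is recognized by [drop_code], since [item] is 0 at pause symbols too. *)
Definition prefix_code (z w : nat) : bool :=
  all (fun i => (drop_code z i == 0) ||
    (~~ (drop_code w i == 0) && (item w i == item z i))) (iota 0 z).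

Lemma prefix_codeP s r :
  reflect (exists t, r = s ++ t) (prefix_code (encode_seq s) (encode_seq r)).
Proof.
apply: (iffP allP) => [h|[t ->] i _].
  have {}h i : i < size s -> i < size r /\ nth None r i = nth None s i.
    move=> hi; have := h i; rewrite mem_iota (leq_trans hi (size_encode_seq s))
      => /(_ isT).
    rewrite !drop_code_encode_seq_eq0 leqNgt hi -ltnNge /= !item_encode_seq =>
      /andP[-> /eqP].
    by move=> /encode_option_inj.
  exists (drop (size s) r); rewrite -[LHS](cat_take_drop (size s)); congr cat.
  have sr : size s <= size r.
    by case: (size s) h => // n h; have [] := h n (ltnSn n).
  apply: (@eq_from_nth _ None) => [|i]; rewrite size_takel // => hi.
  by rewrite nth_take // (h i hi).2.
rewrite !drop_code_encode_seq_eq0 size_cat !item_encode_seq nth_cat.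
by case: (ltnP i (size s)) => //= hi; rewrite -ltnNge ltn_addr // eqxx.
Qed.

(* A stabilizing sequence; otherwise the sequences of [X] could be extended again
   and again with a change of mind, which yields a text without convergence. *)
Lemma stabilizing_sequence (M : learner) (X : set nat) :
  (forall T, content T `<=` X -> exists v, converges_to M T v) ->
  exists2 s, forall x, Some x \in s -> X x &
    forall t, (forall x, Some x \in t -> X x) -> M (s ++ t) = M s.
Proof.
move=> hM; apply: contrapT => hno.
have hext (s : seq (option nat)) : exists t, (forall x, Some x \in s -> X x) ->
    (forall x, Some x \in t -> X x) /\ M (s ++ t) <> M s.
  have [hs|] := pselect (forall x, Some x \in s -> X x); last by exists [::].
  apply: contrapT => hn; apply: hno; exists s => // t ht;
    apply: contrapT => hne.
  by apply: hn; exists t.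
have [e he] := choice hext.
pose sigma k := iter k (fun s => s ++ e s) [::].
have sX k : forall x, Some x \in sigma k -> X x.
  elim: k => [|k IH] x //=; rewrite mem_cat => /orP[/IH //|].
  by have [h _] := he _ IH; apply: h.
(* An extension that changes the hypothesis is nonempty. *)
have ssize k : k <= size (sigma k).
  elim: k => // k IH /=; rewrite size_cat; have [_] := he _ (sX k).
  by case: (e (sigma k)) => [|o u] /=; [rewrite cats0|lia].
have sprefix k j : exists t, sigma (k + j) = sigma k ++ t.
  elim: j => [|j [t ht]]; first by exists [::]; rewrite addn0 cats0.
  by exists (t ++ e (sigma (k + j))); rewrite addnS /= ht catA.
have snth k i : i < size (sigma k) -> nth None (sigma i.+1) i = nth None (sigma
  k) i.
  move=> hi; have := ssize i.+1.
  case: (leqP i.+1 k) => h hs.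
    by have [t] := sprefix i.+1 (k - i.+1); rewrite subnKC // => ->;
      rewrite nth_cat hs.
  by have [t] := sprefix k (i.+1 - k); rewrite subnKC ?(ltnW h) // => ->;
    rewrite nth_cat hi.
(* The limit of the chain: [sigma i.+1] is long enough to have a position [i], and its successors
   agree with it there. *)
pose T i := nth None (sigma i.+1) i.
have Tprefix k : mkseq T (size (sigma k)) = sigma k.
  apply: (@eq_from_nth _ None); rewrite size_mkseq // => i hi.
  by rewrite nth_mkseq // /T (snth k).
have [v [N hN]] : exists v, converges_to M T v.
  apply: hM => x [i Ti]; apply: (sX i.+1); rewrite -Ti; apply: mem_nth;
    exact: ssize.
have Mv k : N <= k -> M (sigma k) = v.
  by move=> Nk; rewrite -(Tprefix k) hN //; exact: leq_trans (ssize k).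
by have [_ []] := he _ (sX N); rewrite -[_ ++ _]/(sigma N.+1) !Mv.
Qed.

(** * Initial unions of classes *)

Section LeastRepresentatives.
Variables (eta : nat -> nat -> Prop) (a : nat -> nat).
Hypotheses (eta_pos : positive eta) (a_reps : least_reps eta a).

Let eta_refl x : eta x x.
Proof. by case: (positive_equiv eta_pos). Qed.

Let eta_sym x y : eta x y -> eta y x.
Proof. by case: (positive_equiv eta_pos) => _ + _; apply. Qed.

Let eta_trans y x z : eta x y -> eta y z -> eta x z.
Proof. by case: (positive_equiv eta_pos) => _ _; apply. Qed.

Let A := initial_union eta a.

Lemma eta_Sigma1 : Sigma1 (fun z => eta (nfst z) (nsnd z)).
Proof. exact: (re_Sigma1 (positive_re eta_pos)). Qed.

Lemma rep_least n y : eta y (a n) -> a n <= y.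
Proof.
have [_ /(congr1 (@^~ (a n)))] := a_reps.
have an : range a (a n) by exists n.
by rewrite /= propeqE => -[/(_ an) + _] => /(_ y).
Qed.

Lemma rep_lt m n : m < n -> a m < a n.
Proof. by case: a_reps => + _; apply. Qed.

Lemma leq_rep n : n <= a n.
Proof. by elim: n => // n IH; apply: (leq_ltn_trans IH); exact: rep_lt. Qed.

Lemma rep_ltE m n : (a m < a n) = (m < n).
Proof.
case: (ltngtP m n) => [/rep_lt -> //|/rep_lt h|->]; last by rewrite ltnn.
by apply/negbTE; rewrite -leqNgt ltnW.
Qed.

Lemma rep_eta_inj m n : eta (a m) (a n) -> m = n.
Proof.
move=> h; have := rep_least h; have := rep_least (eta_sym h).
by case: (ltngtP m n) => // /rep_lt; case: ltngtP.
Qed.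

Lemma rep_exists x : exists2 n, eta x (a n) & a n <= x.
Proof.
have [y /asboolP hy ymin] :=
  ex_minnP (ex_intro (fun y => `[< eta y x >]) x (asboolT (eta_refl x))).
have [_ /(congr1 (@^~ y))] := a_reps.
rewrite /= propeqE => -[_ /(_ _) [z hz|n _ an]].
  by apply: ymin; apply/asboolP; exact: eta_trans hz hy.
exists n; rewrite an; first exact: eta_sym.
by apply: ymin; apply/asboolP.
Qed.

Lemma rep0 : a 0 = 0.
Proof.
by have [n _] := rep_exists 0; rewrite leqn0 => /eqP an; move: (leq_rep n);
  rewrite an leqn0 => /eqP n0; rewrite -{1}n0.
Qed.

Lemma initial_unionE n x : A n x <-> exists2 m, m < n & eta x (a m).
Proof. by split=> -[m mn hm]; exists m. Qed.

Lemma initial_union_rep n p x : eta x (a p) -> A n x <-> p < n.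
Proof.
move=> h; split=> [/initial_unionE [m mn hm]|pn];
  last by apply/initial_unionE; exists p.
by have -> : p = m by apply: rep_eta_inj; apply: eta_trans hm; exact: eta_sym.
Qed.

Lemma initial_union_inj : injective A.
Proof.
move=> m n mn; suff h p q : A p = A q -> p <= q.
  by apply/eqP; rewrite eqn_leq !h.
case: p => // p e; apply/(initial_union_rep q (eta_refl (a p))).
by rewrite -e; apply/initial_unionE; exists p.
Qed.

Lemma eqclassE x y : eqclass eta x = eqclass eta y <-> eta x y.
Proof.
split=> [h|xy]; first by have : eqclass eta y x by rewrite -h; apply: eta_refl.
by apply/seteqP; split=> z /= h;
  [apply: eta_trans h xy|apply: eta_trans h (eta_sym xy)].
Qed.

(** A nonempty [A m] contains [a 0], which is not equivalent to [a n.+1]. *)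
Lemma eqclass_rep_neq n m : eqclass eta (a n.+1) <> A m.
Proof.
case: m => [|m] /seteqP [h1 h2].
  by have /initial_unionE [] := h1 _ (eta_refl (a n.+1)).
have /rep_eta_inj // : eta (a 0) (a n.+1).
by apply: h2; apply/initial_unionE; exists 0.
Qed.

(** Only positive information on [eta] enters: if every number below an entry of [l] is equivalent
    to an earlier entry, then entry [i] belongs to [A i.+1]. The representatives themselves form
    such a list. *)
Lemma initial_union_Sigma1 : Sigma1 (fun z => A (nfst z) (nsnd z)).
Proof.
have hE := eta_Sigma1.
have h : Sigma1 (fun z => exists l, (exists i, i < nfst z /\ eta (nsnd z)
  (entry l i)) /\
    forall j, j < nfst z -> forall y, y < entry l j -> exists k, k < j /\ eta y
      (entry l k)).
  by arithmeticity Sigma1_closed.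
apply: (class_ext h) => z; move: (nfst z) (nsnd z) => n x.
split=> [[l [[i [hi hx]] hl]]|/initial_unionE [m mn hm]].
  suff : forall i, i < n -> A i.+1 (entry l i).
    move=> /(_ i hi) /initial_unionE [m mi hm]; apply/initial_unionE; exists m.
      by lia.
    exact: eta_trans hx hm.
  elim/ltn_ind => {hx}{}i IH {}hi.
  have [p hp pl] := rep_exists (entry l i).
  apply/(initial_union_rep _ hp); rewrite ltnNge; apply/negP => ip.
  (* If [p > i], then [a i] lies below entry [i] and is equivalent to an entry [k < i], although
     [A k.+1] does not contain [a i]. *)
  have [k [ki hk]] := hl i hi (a i) (leq_trans (rep_lt ip) pl).
  have /(initial_union_rep _ (eta_sym hk)) := IH k ki (ltn_trans ki hi).
  by lia.
have [l [hl _]] := sequence_code a n; exists l; split.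
  by exists m; rewrite hl.
move=> j jn y; rewrite hl // => yj; have [k hk ky] := rep_exists y.
have kj : k < j by rewrite -rep_ltE (leq_ltn_trans ky).
by exists k; split=> //; rewrite hl // (ltn_trans kj).
Qed.

(** * A one-one numbering *)

Variable S : set nat.
Hypothesis S_Sigma2 : Sigma2 S.

(** The class of the theorem, with a Sigma_2 set [S] in place of [K']. *)
Let C := range A `|` [set eqclass eta (a n.+1) | n in S].

Lemma class_infinite : infinite_set C.
Proof.
apply: (sub_infinite_set (A := range A)); first by left.
by rewrite (eq_finite_set (inj_card_eq (in2W initial_union_inj)));
  exact: infinite_nat.
Qed.

(** Serves for closedness and for the default interpretation of hypotheses. *)
Lemma eta_closure_class L : C L -> eta_closure eta L = L.
Proof.
have h X : (forall x y, X x -> eta y x -> X y) -> eta_closure eta X = X.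
  move=> hX; apply/seteqP; split=> [x [y hy /= xy]|x hx].
    exact: hX hy xy.
  by exists x => //; apply: eta_refl.
move=> [[n _ <-]|[n _ <-]]; apply: h => x y /=.
  move=> /initial_unionE [m mn hm] yx; apply/initial_unionE; exists m => //.
  exact: eta_trans yx hm.
by move=> h yx; apply: eta_trans yx h.
Qed.

(** The class of [a n.+1] is the difference of [A n.+2] and [A n.+1], and [a n.+1] is its least
    element; non-membership and minimality are Pi_1. *)
Lemma rep_pred_Sigma2 :
  Sigma2 (fun x => S (nfst x) /\ nsnd x = a (nfst x).+1).
Proof.
have hA := initial_union_Sigma1; have hE := eta_Sigma1.
have h : Sigma2 (fun x => S (nfst x) /\ (A (nfst x).+2 (nsnd x) /\
    (~ A (nfst x).+1 (nsnd x) /\ forall y, y < nsnd x -> ~ eta y (nsnd x)))).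
  by arithmeticity Sigma2_closed.
apply: (class_ext h) => x; move: (nfst x) (nsnd x) => n b.
split=> [[Sn [/initial_unionE [m mn hm] [bA bmin]]]|[Sn ->]]; split=> //.
  have em : m = n.+1.
    apply/eqP; rewrite eqn_leq -ltnS mn /= ltnNge; apply/negP => mn'.
    by apply: bA; apply/initial_unionE; exists m.
  rewrite em in hm; apply/eqP; rewrite eq_sym eqn_leq rep_least //= leqNgt.
  by apply/negP => /bmin; apply; apply: eta_sym.
rewrite !(initial_union_rep _ (eta_refl _)) !ltnS ltnn leqnn; do 2!split=> //.
by move=> y + /rep_least; rewrite ltnNge => /negP.
Qed.

(* The numbers [<k, j>] with [k = <<n, b>, w>] share the sets [A_<k, s>] among
   them. The first one enumerates [b] as long as [w] is not refuted as a
   witness of [n \in S] and [b = a_(n+1)]; after a first refutation at [t] it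
   turns into [A_<k, t>], and the numbers [<k, j.+1>] with [j >= t] shift by one,
   so as to avoid this set. *)
Lemma class_numbering :
  exists B : nat -> set nat, [/\ re2 B, injective B & range B = C].
Proof.
have hA := initial_union_Sigma1; have hE := eta_Sigma1.
have [F hF [FP Funiq]] := Sigma2_unique_witness rep_pred_Sigma2.
(* For [nsnd i = j.+1] the summand is 1 exactly if there is a refutation [t <= j]. *)
pose B i : set nat := fun z =>
  (nsnd i = 0 /\
    ((~~ F (nfst i) 0 /\ eta z (nsnd (nfst (nfst i)))) \/
     exists t, (F (nfst i) t && all (fun s => ~~ F (nfst i) s) (iota 0 t)) /\
       A (npair (nfst i) t) z)) \/
  (0 < nsnd i /\
    A (npair (nfst i) ((nsnd i).-1 +
      ~~ all (fun s => ~~ F (nfst i) s) (iota 0 (nsnd i)))) z).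
have hB : re2 B.
  apply: Sigma1_re; rewrite /B /mkset; arithmeticity Sigma1_closed.
pose good k := forall t, ~~ F k t.
pose first k t := F k t /\ forall s, s < t -> ~~ F k s.
have goodP k : good k \/ exists t, first k t.
  have [|/existsNP [t /negP]] := pselect (good k);
    [by left|rewrite negbK => Ft].
  have [m hm mmin] := ex_minnP (ex_intro (F k) t Ft); right; exists m;
    split=> // s.
  by apply: contraTN => /mmin; rewrite -leqNgt.
have good_rep k : good k -> S (nfst (nfst k)) /\ nsnd (nfst k) = a (nfst (nfst
  k)).+1.
  by move=> gk; apply/FP; exists (nsnd k); rewrite npairK.
have allFE k j : all (fun s => ~~ F k s) (iota 0 j) <-> forall s, s < j -> ~~ F
  k s.
  split=> [/allP h s hs|h]; first by apply: h; rewrite mem_iota.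
  by apply/allP => s; rewrite mem_iota => /h.
have B_good0 k : good k -> B (npair k 0) = eqclass eta (a (nfst (nfst k)).+1).
  move=> gk; have [_ bE] := good_rep _ gk; rewrite -bE; apply/seteqP.
  rewrite /B !npE; split=> z /=; last by left; split=> //; left.
  by case=> [[_ [[] //|[t [/andP[]]]]]|[]] //; rewrite (negbTE (gk t)).
have B_good j k : good k -> B (npair k j.+1) = A (npair k j).
  move=> gk; rewrite /B !npE.
  have -> : all (fun s => ~~ F k s) (iota 0 j.+1) by apply/allFE.
  by rewrite addn0; apply/seteqP; split=> z /= => [[[]|[]]|] //; right.
have B_first0 k t : first k t -> B (npair k 0) = A (npair k t).
  move=> [Ft tmin]; rewrite /B !npE; apply/seteqP; split=> z /=.
    case=> [[_ [[F0 hz]|[s [/andP [Fs /allFE smin] hs]]]]|[]] //; last first.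
      have -> // : t = s.
      by case: (ltngtP s t) => // [/tmin|/smin]; rewrite ?Fs ?Ft.
    (* The class of [b] was enumerated before the refutation, but it is contained in [A_<k, t>], as
       its index [p] satisfies [p <= b <= k < <k, t>]. *)
    have [p hp pb] := rep_exists (nsnd (nfst k)).
    apply/(initial_union_rep _ (eta_trans hz hp)).
    have t0 : 0 < t by case: (t) Ft F0 => // ->.
    have := leq_rep p; have := leq_npair k t; have := leq_nsnd (nfst k).
    by have := leq_nfst k; lia.
  move=> hz; left; split=> //; right; exists t; split=> //; rewrite Ft /=.
  exact/allFE.
have B_first j k t : first k t -> B (npair k j.+1) = A (npair k (j + (t <= j))).
  move=> [Ft tmin]; rewrite /B !npE.
  have -> : ~~ all (fun s => ~~ F k s) (iota 0 j.+1) = (t <= j).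
    apply/idP/idP => [|tj]; last by apply/negP => /allFE /(_ t tj); rewrite Ft.
    apply: contraNT; rewrite -ltnNge => jt.
    by apply/allFE => s sj; apply: tmin; apply: leq_trans jt.
  by apply/seteqP; split=> z /= => [[[]|[]]|] //; right.
have first_inj k t t' : first k t -> first k t' -> t = t'.
  by move=> [h1 h2] [h1' h2']; case: (ltngtP t t') => // [/h2'|/h2];
    rewrite ?h1 ?h1'.
(* As in Hilbert's hotel, [<k, j>] receives the set [A_<k, s>]; for a good [k] the number [<k, 0>]
   is not among the guests. *)
pose hotel k j s := (good k /\ j = s.+1) \/ exists2 t, first k t &
   s = if j is j'.+1 then j' + (t <= j') else t.
have hotel_inj k j j' s : hotel k j s -> hotel k j' s -> j = j'.
  move=> [[gk ->]|[t [Ft tmin] sE]] [[gk' ->]|[t' tF' sE']] //.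
  - by case: tF'; rewrite (negbTE (gk _)).
  - by move: Ft; rewrite (negbTE (gk' _)).
  - have tt : t = t' by apply: first_inj tF'.
    move: sE sE'; rewrite -tt {tmin tF' tt} => ->.
    by case: j j' => [|j] [|j'] //; lia.
have hotelP k j : (good k /\ j = 0) \/
    exists2 s, hotel k j s & B (npair k j) = A (npair k s).
  have [gk|[t tF]] := goodP k.
    case: j => [|j]; [by left|right; exists j; last exact: B_good].
    by left.
  right; exists (if j is j'.+1 then j' + (t <= j') else t).
    by right; exists t.
  by case: j => [|j]; [exact: B_first0|exact: B_first].
exists B; split=> //.
- move=> i i'; rewrite -(npairK i) -(npairK i').
  move: (nfst i) (nsnd i) (nfst i') (nsnd i') => k j k' j'.
  have [[gk ->]|[s hs ->]] := hotelP k j;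
    have [[gk' ->]|[s' hs' ->]] := hotelP k' j'.
  (* Equal classes have the same [n], hence the same [b], and the unrefuted witness is unique. *)
  + rewrite !B_good0 // => /eqclassE /rep_eta_inj [nn].
    have [_ bE] := good_rep _ gk; have [_ bE'] := good_rep _ gk'.
    have xx : nfst k = nfst k'.
      by rewrite -(npairK (nfst k)) -(npairK (nfst k')) bE bE' nn.
    have ww : nsnd k = nsnd k'.
      by apply: (Funiq (nfst k)) => t; rewrite ?npairK // xx npairK.
    by congr npair; rewrite -(npairK k) xx ww npairK.
  + by rewrite B_good0 // => /eqclass_rep_neq.
  + by rewrite B_good0 // => /esym /eqclass_rep_neq.
  + move=> /initial_union_inj /npair_inj [kk ss]; congr npair => //.
    by apply: (hotel_inj k _ _ s) => //; rewrite kk ss.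
- apply/seteqP; split=> [_ [i _ <-]|L [[m _ <-]|[n Sn <-]]].
  + rewrite -(npairK i); have [[gk ->]|[s _ ->]] := hotelP (nfst i) (nsnd i).
      rewrite B_good0 //; right; exists (nfst (nfst (nfst i))) => //.
      by have [] := good_rep _ gk.
    by left; exists (npair (nfst i) s).
  + rewrite -(npairK m); move: (nfst m) (nsnd m) => k s.
    have [gk|[t tF]] := goodP k; first by exists (npair k s.+1) => //;
      rewrite B_good.
    (* The second component is [s.+1] for [s < t], 0 for [s = t] and [s] for [s > t]. *)
    case: (ltngtP s t) => [st|ts|->]; last by exists (npair k 0) => //;
      apply: B_first0.
      by exists (npair k s.+1) => //;
        rewrite (B_first _ _ _ tF) leqNgt st addn0.
    exists (npair k s) => //; case: s ts => // s ts.
    by rewrite (B_first _ _ _ tF) -ltnS ts addn1.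
  + have /FP [w gw] : S (nfst (npair n (a n.+1))) /\
        nsnd (npair n (a n.+1)) = a (nfst (npair n (a n.+1))).+1 by rewrite
          !npE.
    by exists (npair (npair (npair n (a n.+1)) w) 0) => //;
      rewrite B_good0 // !npE.
Qed.
(** * Learning *)

Lemma class_learnable (W : nat -> set nat) : acceptable_re W ->
  weakly_confidently_learnable W eta C.
Proof.
move=> [_ hW]; have hE := eta_Sigma1.
(* For [x > 0], [<x, d>] stands for the union of the classes of all [y < x]; [<0, 0>] stands for the
   empty set and [<0, d.+1>] for the class of [d]. *)
pose V h : set nat := fun z => (exists y, y < nfst h /\ eta z y) \/
  (nfst h = 0 /\ (0 < nsnd h /\ eta z (nsnd h).-1)).
have [|c hc VW] := hW V.
  by apply: Sigma1_re; rewrite /V /mkset; arithmeticity Sigma1_closed.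
have {}hc := recursive_computable hc.
(* As the projection of a decidable relation, equivalence can be tested up to a stage. *)
have [_ [r hr ->] etaE] := hE.
have {}etaE x y : eta x y <-> exists t, r (npair (npair x y) t).
  by have := congr1 (@^~ (npair x y)) etaE; rewrite /= !npE => ->.
pose candidate z x :=
  all (fun y => all (fun t => ~~ r (npair (npair y x) t)) (iota 0 z)) (iota 0
    x) &&
  all (fun i => ~~ (item z i == x.+1)) (iota 0 z).
pose gap z := find (candidate z) (iota 0 z).
pose g z := c (npair (gap z) (first_datum z)).
pose M : learner := fun s => Some (g (encode_seq s)).
have hg : computable g.
  by rewrite /g /gap /candidate /first_datum; computability.
have gap_converges T m : (forall j, j < m -> content T (a j)) -> ~ content T (a
  m) ->
    exists N, forall n, N <= n -> gap (encode_seq (mkseq T n)) = a m.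
  move=> hin hout.
  pose z n := encode_seq (mkseq T n).
  (* A representative [x < a m] occurs in the data by assumption; any other [x < a m] is eventually
     found equivalent to a smaller number. *)
  have [|N hN] := @eventually_below (fun x n => ~~ candidate (z n) x) (a m).
    move=> x xm; have [p xp px] := rep_exists x.
    have pm : p < m by rewrite -rep_ltE (leq_ltn_trans px).
    move: px; rewrite leq_eqVlt => /orP[/eqP ap|apx].
      have [i Ti] := hin p pm; exists i.+1 => n ni;
        rewrite /candidate negb_and; apply/orP; right.
      apply/negP => /allP /(_ i); rewrite item_mkseq // Ti ap /= eqxx mem_iota.
      by rewrite (leq_trans ni (leq_code_mkseq T n)) => /(_ isT).
    have /etaE [t rt] := eta_sym xp; exists t.+1 => n nt;
      rewrite /candidate negb_and; apply/orP; left.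
    apply/negP => /allP /(_ (a p));
      rewrite mem_iota apx => /(_ isT) /allP /(_ t).
    by rewrite mem_iota rt (leq_trans nt (leq_code_mkseq T n)) => /(_ isT).
  exists (maxn N (a m).+1) => n; rewrite geq_max => /andP[/hN hn an].
  rewrite /gap (@find_iota _ (a m)) //;
    last exact: leq_trans an (leq_code_mkseq T n).
  apply/andP; split; apply/allP => y; rewrite mem_iota => /= ym.
    apply/allP => t _; apply/negP => rt.
    have /rep_least : eta y (a m) by apply/etaE; exists t.
    by rewrite leqNgt ym.
  apply/negP; case: (ltnP y n) => yn.
    rewrite item_mkseq //; case E: (T y) => [x|] //= /eqP [xa].
    by apply: hout; exists y; rewrite E xa.
  by rewrite item_encode_seq nth_default ?size_mkseq.
have M_converges T m : (forall j, j < m -> content T (a j)) -> ~ content T (a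
  m) ->
    exists d, converges_to M T (Some (c (npair (a m) d))) /\
      ((d = 0 /\ content T = set0) \/ (0 < d /\ content T d.-1)).
  move=> hin hout; have [N1 h1] := gap_converges T m hin hout.
  have [d [[N2 h2] hd]] := first_datum_converges T.
  exists d; split=> //; exists (maxn N1 N2) => n;
    rewrite geq_max => /andP[/h1 n1 /h2 n2].
  by rewrite /M /g n1 n2.
have V0 d : V (npair (a 0) d.+1) = eqclass eta d.
  apply/seteqP; rewrite /V !npE rep0; split=> z /=; last by right.
  by case=> [[y []]|[_ []]].
have VS m d : V (npair (a m.+1) d) = A m.+1.
  apply/seteqP; rewrite /V !npE; split=> z.
    case=> [[y [ym zy]]|[am]]; last by have := leq_rep m.+1; rewrite am.
    have [p yp py] := rep_exists y;
      apply/(initial_union_rep _ (eta_trans zy yp)).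
    by rewrite -rep_ltE (leq_ltn_trans py).
  by move=> /initial_unionE [p pm zp]; left; exists (a p); split=> //;
    exact: rep_lt.
exists M; first by exists (fun z => (g z).+1) => //;
  apply: computable_recursive; computability.
split=> [L T CL TL|L T CL TL]; last first.
  (* The content lies in some [A N] and omits [a N], so that there is a least [m] with [a m] outside
     of the content. *)
  have [N LN] : exists N, L `<=` A N.
    case: CL => [[n _ <-]|[n _ <-]]; first by exists n.
    by exists n.+2 => x hx; apply/initial_unionE; exists n.+1.
  have hN : `[< ~ content T (a N) >].
    by apply/asboolP => /TL /LN;
      rewrite (initial_union_rep _ (eta_refl _)) ltnn.
  have [m /asboolP hm mmin] := ex_minnP (ex_intro (fun m => `[< ~ content T (a
    m) >]) N hN).
  have [|d [hd _]] := M_converges T m _ hm; last by eexists; exact: hd.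
  by move=> j jm; apply: contrapT => /asboolT /mmin; rewrite leqNgt jm.
suff [m [hin hout hV]] : exists m, [/\ forall j, j < m -> content T (a j),
    ~ content T (a m) & forall d, (d = 0 /\ content T = set0) \/
       (0 < d /\ content T d.-1) -> V (npair (a m) d) = L].
  have [d [hd dT]] := M_converges T m hin hout;
    exists (c (npair (a m) d)) => //.
  by rewrite -VW hV // eta_closure_class.
(* The least missing representative is [a n] for [A n], and [a 0] for a class [[a_(n+1)]]. *)
case: CL TL => [[n _ <-]|[n Sn <-]] TL; [exists n|exists 0]; split;
  rewrite TL //.
- by move=> j jn; apply/initial_unionE; exists j.
- by rewrite (initial_union_rep _ (eta_refl _)) ltnn.
- case: n TL => [|n] TL d dT; last exact: VS.
  case: d dT => [|d] [[] // _|[] // _ /initial_unionE []] // _.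
  apply/seteqP; rewrite /V !npE rep0; split=> z.
    by case=> [[y []]|[_ []]].
  by move=> /initial_unionE [].
- by move=> /rep_eta_inj.
- case=> [|d] [[] // _ T0|[] // _ dT].
    have : eqclass eta (a n.+1) (a n.+1) by apply: eta_refl.
    by rewrite T0.
  by rewrite V0; apply/eqclassE.
Qed.

(** * Class-preserving learners and diagonalization *)

Lemma complement_Sigma2 :
  class_preservingly_weakly_confidently_learnable C -> Sigma2 (fun n => ~ S n).
Proof.
move=> [H [/re_Sigma1 hH rangeH [M [f /recursive_computable hf fM] [learns
  conv]]]].
have {}hH : Sigma1 (fun z => H (nfst z) (nsnd z)) by exact: hH.
have hA := initial_union_Sigma1; have hE := eta_Sigma1.
pose inclass z b := forall i, i < z -> item z i = 0 \/ eta (item z i).-1 b.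
have inclassP s b : inclass (encode_seq s) b <-> forall x, Some x \in s -> eta
  x b.
  split=> [h x /(nthP None) [i hi xi]|h i hi].
    by have := h i (leq_trans hi (size_encode_seq s));
      rewrite item_encode_seq xi => -[].
  rewrite item_encode_seq; case E: (nth None s i) => [x|]; [right|by left].
  by apply: h; rewrite -E mem_nth // ltnNge;
    apply/negP => /(nth_default None); rewrite E.
(* Here [b] is any element of [[a_(n+1)]], which avoids a reference to [a]; [s] codes a stabilizing
   sequence, and [f s = 0] means the output ?. Stability is a negated Sigma_1 statement. *)
have h : Sigma2 (fun n => exists b, exists s,
    A n.+2 b /\ (~ A n.+1 b /\
    ((forall i, i < s -> item s i = 0 \/ eta (item s i).-1 b) /\
    ((~ exists w, prefix_code s w /\
      ((forall i, i < w -> item w i = 0 \/ eta (item w i).-1 b) /\ ~~ (f w == f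
        s))) /\
    (f s = 0 \/ (H (f s).-1 0 \/ ~ H (f s).-1 b)))))).
  by rewrite /prefix_code; arithmeticity Sigma2_closed.
apply: (class_ext h) => n.
have CA m : C (A m) by left; exists m.
split=> [[b [z [bA [bA' [zb [stab out]]]]]] Sn|Sn].
  have [p pn bp] : exists2 p, p < n.+2 & eta b (a p) by apply/initial_unionE.
  have pE : p = n.+1.
    apply/eqP; rewrite eqn_leq -ltnS pn /= ltnNge; apply/negP => pn'.
    by apply: bA'; apply/initial_unionE; exists p.
  rewrite {}pE {pn} in bp.
  have [s sz] := encode_seq_surj z; rewrite -{z}sz in zb stab out.
  move/inclassP: zb => sb; rewrite fM in out.
  have CL : C (eqclass eta b) by right; exists n => //; apply/eqclassE;
    exact: eta_sym.
  (* A text for the class of [b] that starts with [s]; then each number is listed in turn, with a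
     pause in place of non-elements. *)
  pose T i := if i < size s then nth None s i else
    if `[< eta (i - size s) b >] then Some (i - size s) else None.
  have Tb i x : T i = Some x -> eta x b.
    rewrite /T; case: ltnP => hi; first by move=> E; apply: sb;
      rewrite -E mem_nth.
    by case: asboolP => // + [<-].
  have TL : content T = eqclass eta b.
    apply/seteqP; split=> x /=; first by move=> [i /Tb].
    by move=> xb; exists (size s + x);
      rewrite /T ltnNge leq_addr /= addKn asboolT.
  have [e [N hN] He] := learns _ _ CL TL.
  have Ms : M s = Some e.
    rewrite -(hN (maxn N (size s))) ?leq_maxl //.
    have [t tE] : exists t, mkseq T (maxn N (size s)) = s ++ t.
      exists (drop (size s) (mkseq T (maxn N (size s)))).
      rewrite -[LHS](cat_take_drop (size s)); congr cat.
      have hs : size s <= size (mkseq T (maxn N (size s))) by rewrite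
        size_mkseq leq_maxr.
      apply: (@eq_from_nth _ None); rewrite size_takel // => i hi.
      by rewrite nth_take // nth_mkseq ?(leq_trans hi) ?leq_maxr // /T hi.
    apply: contrapT => ne; apply: stab;
      exists (encode_seq (mkseq T (maxn N (size s)))).
    split; first by apply/prefix_codeP; exists t.
    split; last by apply/negP => /eqP; rewrite !fM => /encode_option_inj /esym.
    apply/inclassP => x /mapP [i _] /esym; exact: Tb.
  move: out; rewrite Ms He /= => -[|[b0|]] //; last by apply; apply: eta_refl.
  have : eta (a 0) (a n.+1) by rewrite rep0; apply: eta_trans b0 bp.
  by move/rep_eta_inj.
pose b := a n.+1; have bE : eta b b := eta_refl b.
(* Since [[a_(n+1)]] is contained in the member [A n.+2] of the class, the learner converges on all
   texts for its subsets. *)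
have [|s sb stab] := @stabilizing_sequence M (eqclass eta b).
  move=> T TL; apply: (conv (A n.+2)) => // x /TL xb.
  by apply/initial_unionE; exists n.+1.
exists b, (encode_seq s); rewrite !(initial_union_rep _ bE) ltnS leqnn ltnn.
do 2!split=> //; split; first by apply/inclassP.
split.
  move=> [w []]; have [r <-] := encode_seq_surj w; move=> /prefix_codeP [t ->].
  move=> [/inclassP hr] /negP; apply; rewrite !fM stab // => x xt.
  by apply: hr; rewrite mem_cat xt orbT.
rewrite fM; case: (M s) => [e|]; [right|by left].
have [H0|nH0] := pselect (H e 0); [by left|right => /= Hb].
(* A member of the class that contains [b] but not 0 is some [[a_(m+1)]] with [m] in [S]; containing
   [b], it has [m = n]. *)
have : C (H e) by rewrite -rangeH; exists e.
case=> [[[|m] _ mE]|[m Sm mE]].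
- by move: Hb; rewrite -mE => /initial_unionE [].
- by apply: nH0; rewrite -mE; apply/initial_unionE; exists 0; rewrite ?rep0.
- by move: Hb; rewrite -mE => /rep_eta_inj [nm]; apply: Sn; rewrite nm.
Qed.

End LeastRepresentatives.

(** With oracle [K] a program can search for a [p] that satisfies the Pi_1 matrix [Q]; it halts
    exactly on the elements of [P]. Its index [e] is applied to itself. *)
Lemma Sigma2_index phi P : acceptable_system phi -> Sigma2 P ->
  exists e, jump phi (halting_problem phi) e <-> P e.
Proof.
move=> hphi [Q /Sigma1_re [g [cg gE] QE] ->].
(* Since [g] sees the parameter only, the program [f z] halts on all inputs, its own index included,
   or on none. *)
have hg : partial_recursive_in set0 (fun z y => g (nfst z) y).
  exists (CComp cg CFst) => x y /=; split=> [/gE|[u -> /gE] //].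
  by exists (nfst x).
have [_ /(_ _ hg) [f /recursive_computable [cf hf] fE]] := hphi set0.
have KE z : halting_problem phi (f z) <-> ~ Q z.
  have -> : (~ Q z) = exists y, g z y by rewrite (congr1 (@^~ z) QE).
  by split=> -[y hy]; exists y; move: hy; rewrite -fE nfstE.
set K := halting_problem phi in KE *.
(* The oracle answer 0, which ends the search, means that [Q] holds. *)
pose c := CMu (CComp COracle cf).
have cE x p v : eval K (CComp COracle cf) (npair x p) v <->
    v = nat_of_bool `[< ~ Q (npair x p) >].
  have -> : `[< ~ Q (npair x p) >] = `[< K (f (npair x p)) >].
    by apply/asbool_equiv_eq; split=> /KE.
  by rewrite /=; split=> [[u /hf ->]|->] //; exists (f (npair x p));
    first exact/hf.
have PE x : (exists p, eval K c x p) <-> exists p, Q (npair x p).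
  split=> [[p [/cE + _]]|[p0 hp0]].
    by case: asboolP => // /contrapT hp _; exists p.
  have [p /asboolP hp pmin] :=
    ex_minnP (ex_intro (fun p => `[< Q (npair x p) >]) p0 (asboolT hp0)).
  exists p; split=> [|m mp]; first by apply/cE; rewrite asboolF // => /(_ hp).
  exists 0; apply/cE; rewrite asboolT // => /asboolT /pmin.
  by rewrite leqNgt mp.
(* The parameter is ignored, so that [f' 0] is an index of [c]. *)
have hc : partial_recursive_in K (fun z y => eval K c (nsnd z) y).
  exists (CComp c CSnd) => x y; split=> [h|[u -> //]].
  by exists (nsnd x).
have [_ /(_ _ hc) [f' _ fE']] := hphi K.
exists (f' 0); rewrite -PE.
by split=> -[y hy]; exists y; move: hy; rewrite -fE' nsndE.
Qed.

Lemma jump_Sigma2 phi : acceptable_system phi ->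
  Sigma2 (jump phi (halting_problem phi)).
Proof.
move=> hphi.
(* One argument for both jumps: the empty set and its complement are Sigma_1; [K] and its complement
   are Sigma_2. *)
have diag G A : closed_class G -> G A -> G (fun x => ~ A x) -> G (jump phi A).
  move=> cG hA hN; have [[c cE] _] := hphi A.
  have hc := closed_eval cG c hA hN.
  have : G (fun e => exists y, eval A c (npair e e) y) by arithmeticity cG.
  move/class_ext; apply=> e; split=> -[y hy]; exists y; move: hy;
    rewrite -cE !npE //.
have hK : Sigma1 (halting_problem phi).
  have [h0 h0'] := closed_set0 Sigma1_closed.
  exact: (diag _ _ Sigma1_closed).
apply: diag; [exact: Sigma2_closed|exact: Sigma1_Sigma2|exact: Pi1_Sigma2].
Qed.

Theorem theorem13 (phi : set nat -> nat -> nat -> nat -> Prop)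
    (W : nat -> set nat) (eta : nat -> nat -> Prop) (a : nat -> nat) :
  acceptable_system phi -> acceptable_re W ->
  positive eta -> least_reps eta a ->
  let K' := jump phi (halting_problem phi) in
  let C := range (initial_union eta a) `|`
           [set eqclass eta (a n.+1) | n in K'] in
  [/\ eta_family eta C,
      weakly_confidently_learnable W eta C &
      ~ class_preservingly_weakly_confidently_learnable C].
Proof.
move=> hphi hW eta_pos a_reps K' C.
have hK' : Sigma2 K' := jump_Sigma2 hphi.
split.
- split; first exact: class_infinite.
    by move=> L CL; exists L; rewrite (eta_closure_class eta_pos CL).
  exact: class_numbering.
- exact: class_learnable.
(* An index [e] of the complement of [K'] would belong to [K'] exactly if it does not. *)
- move=> /(complement_Sigma2 eta_pos a_reps) /(Sigma2_index hphi) [e [h1 h2]].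
  have nKe : ~ K' e by move=> h; exact: (h1 h).
  exact: nKe (h2 nKe).
Qed.
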